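(* Let $\mu \in \mathscr{P}(\mathbb{R})$. The following conditions are equivalent: (a) the equality $$\limsup_{h \searrow 0} \frac{W_p(\mu,\mu_h)}{h} = 1$$ holds for some (equivalently, for any) $p \in [1,\infty)$; (b) for any $\varepsilon > 0$, there exists $A \in \mathscr{A}$ such that $\mu(A) \geqslant 1 - \varepsilon$.
   Context: $\mathscr{P}(\mathbb{R})$ is the set of Borel probability measures on $\mathbb{R}$. For $p\in[1,\infty)$ and $\mu,\nu\in\mathscr{P}(\mathbb{R})$, $W_p(\mu,\nu) := \left(\inf_{\eta} \int_{\mathbb{R}^2} |x-y|^p\, d\eta(x,y)\right)^{1/p} \in [0,\infty]$, where the infimum runs over all Borel probability measures $\eta$ on $\mathbb{R}^2$ with first marginal $\mu$ and second marginal $\nu$ (no moment condition is imposed on $\mu,\nu$; the value is $\infty$ if no plan has finite cost). For $h>0$, $\mu_h := \frac12\left[(\mathrm{id}-h)_{\#}\mu + (\mathrm{id}+h)_{\#}\mu\right]$, where $f_\#\mu$ is the pushforward of $\mu$ by $f$. (One always has $W_p(\mu,\mu_h)\le h$.) The class $\mathscr{A}$: a measurable set $A\subset\mathbb{R}$ belongs to $\mathscr{A}$ if for some sequence $(s_n)_{n\in\mathbb{N}}\subset(0,1)$ with $s_n\to 0$ as $n\to\infty$, there holds $$\lim_{n\to\infty}\ \sup_{x\in A}\ \inf\left\{\tau\in(0,1) \ \middle|\ \mathscr{B}(x,s_n)\cap A\subset\overline{\mathscr{B}}(x,\tau s_n)\right\}=0,$$ where $\mathscr{B}(x,r)$ and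 $\overline{\mathscr{B}}(x,r)$ are the open and closed balls in $\mathbb{R}$ of center $x$ and radius $r$ (with $\inf\emptyset=+\infty$). *)

(* Defs.v *)
From HB Require Import structures.
From mathcomp Require Import all_boot all_order all_algebra.
From mathcomp Require Import all_classical all_reals all_analysis.
From mathcomp Require Import measurable_realfun.

Set Implicit Arguments.
Unset Strict Implicit.
Unset Printing Implicit Defensive.
Import Order.TTheory GRing.Theory Num.Theory.
Import numFieldNormedType.Exports.

Local Open Scope classical_set_scope.
Local Open Scope ring_scope.
Local Open Scope ereal_scope.

(* A measure is a function on all sets, whose values outside the sigma-algebra
   carry no information: equality of marginals is tested on Borel sets only. *)
Definition is_coupling (R : realType) (mu nu : probability R R)
    (eta : probability (R * R)%type R) :=
  forall B : set R, measurable B ->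
    pushforward eta fst B = mu B /\ pushforward eta snd B = nu B.

Definition transport_cost (R : realType) (p : R)
    (eta : probability (R * R)%type R) : \bar R :=
  \int[eta]_z (`|z.1 - z.2| `^ p)%:E.

(* Extended-valued: [+oo `^ r = +oo] for [r != 0]. *)
Definition Wasserstein (R : realType) (p : R) (mu nu : probability R R) :
    \bar R :=
  (ereal_inf [set transport_cost p eta | eta in is_coupling mu nu]) `^ p^-1.

(* mu_h, the half-sum of the images of mu under id - h and id + h *)
Definition split_measure (R : realType) (mu : probability R R) (h : R) :
    set R -> \bar R := fun B =>
  (2^-1)%:E * (pushforward mu (fun x : R => x - h)%R B +
               pushforward mu (fun x : R => x + h)%R B).

Section split_measure_probability.
Context (R : realType) (mu : probability R R) (h : R).

Let measurable_translate (t : R) :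
  measurable_fun [set: R] (fun x : R => x + t)%R.
Proof. by apply: measurable_funD. Qed.

Let translate (t : R) : {mfun R >-> R} :=
  mfun_Sub (mem_set (measurable_translate t)).

Let split_measureE : split_measure mu h =
  mscale (2^-1 : R)%:nng%R
    (measure_add (distribution mu (translate (- h)%R))
                 (distribution mu (translate h))).
Proof.
apply/funext => B; rewrite /split_measure /mscale; congr (_ * _).
by rewrite [RHS]measure_addE.
Qed.

Let split_measure0 : split_measure mu h set0 = 0.
Proof. by rewrite split_measureE measure0. Qed.

Let split_measure_ge0 B : 0 <= split_measure mu h B.
Proof. by rewrite split_measureE measure_ge0. Qed.

Let split_measure_sigma_additive : semi_sigma_additive (split_measure mu h).
Proof. by rewrite split_measureE; exact: measure_semi_sigma_additive. Qed.

HB.instance Definition _ := isMeasure.Build _ _ _ (split_measure mu h)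
  split_measure0 split_measure_ge0 split_measure_sigma_additive.

Let split_measureT : split_measure mu h setT = 1.
Proof.
rewrite /split_measure /pushforward !preimage_setT !probability_setT.
by rewrite -EFinD -EFinM mulVf.
Qed.

HB.instance Definition _ := Measure_isProbability.Build _ _ _
  (split_measure mu h) split_measureT.

End split_measure_probability.

Definition sharp_rate (R : realType) (mu : probability R R) (p : R) :=
  limf_esup (fun h : R => Wasserstein p mu (split_measure mu h) * (h^-1)%:E)
            (0%R : R)^'+ = 1.

(* [ball] is open; as t * r > 0 for r > 0, [closed_ball x (t * r)] is the set of
   y with |x - y| <= t * r. The infimum of the empty set is +oo. *)
Definition local_radius (R : realType) (A : set R) (r x : R) : \bar R :=
  ereal_inf [set t%:E | t in
    [set t : R | (0 < t < 1)%R /\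
                 ball x r `&` A `<=` closed_ball x (t * r)%R]].

(* The supremum over the empty set is -oo, so that set0 is not in the class. *)
Definition classA (R : realType) (A : set R) :=
  measurable A /\
  exists s : R^nat, [/\ forall n, (0 < s n < 1)%R,
    s n @[n --> \oo] --> (0 : R)%R &
    ereal_sup [set local_radius A (s n) x | x in A] @[n --> \oo] --> 0].

(* Main.v *)
Require Import Defs.
From HB Require Import structures.
From mathcomp Require Import all_boot all_order all_algebra.
From mathcomp Require Import all_classical all_reals all_analysis.
From mathcomp Require Import measurable_realfun ring lra.

Set Implicit Arguments.
Unset Strict Implicit.
Unset Printing Implicit Defensive.
Import Order.TTheory GRing.Theory Num.Theory.
Import numFieldNormedType.Exports.

Local Open Scope classical_set_scope.
Local Open Scope ring_scope.

(** At scale [h], the plan that moves every point by [h] to the left or to the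
    right with probability one half costs exactly [h ^ p]. The theorem says that
    it is nearly optimal along some sequence of scales exactly when [mu] nearly
    lives on sets that are clustered at those scales: points closer than [h / 2]
    are in fact much closer than [h].

    Clusters make the plan optimal. If a plan sends most of [A] into
    [(A - h) U (A + h)] and [A] has no two points at a distance between [t h]
    and [2 h], then a moved point of [A] travels at least [(1 - t) h]: it lands
    at distance [h] from a point of [A] which is either close to the starting
    point or at least [2 h] away from it. Both conditions on the endpoints hold
    up to mass [2 e] for any plan, by the marginals alone
    ([Wasserstein_split_ge]).

    Missing clusters give a better plan. Let [X], [Y] both have law [mu]. When
    [t h <= Y - X <= h], exchange the right move of [X] with the left move of
    [Y]: [X] goes to [Y - h] and [Y] goes to [X + h]. The set of targets is
    unchanged, but the distance travelled drops from [h] to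
    [h - (Y - X) <= (1 - t) h]. As any joint law of [(X, Y)] will do, this gives
    [W_p <= h (1 - t P(t h <= Y - X <= h)) ^ (1/p)] ([Wasserstein_swap_le]), so
    that [W_p] close to [h] forces this probability to be small for every
    self-coupling of [mu].

    It is applied to the self-coupling where [Y] is drawn from [mu] conditioned
    on the cell of [X], for a grid of step [h] ([cellwise_product]). Call [x]
    good if less than half of the mass of its cell is at distance at least [t h]
    from [x]. Two good points of a cell are at distance less than [2 t h], as
    the two large subsets of the cell around them must meet, and the bad points
    have small mass by Markov's inequality ([concentratedC_le]). Two grids
    shifted by [h / 2] are enough to have any two points at distance less than
    [h / 2] in a common cell ([cluster_decomposition]). Intersecting such sets
    over a summable sequence of error masses gives the set of the class.

    Both implications are insensitive to [p], whence the equivalence between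
    one exponent and all exponents. *)

(** * Swapping moves between paired points *)

Section half_sum.
Local Open Scope ereal_scope.
Context d (T : measurableType d) (R : realType) (P Q : probability T R).

Definition half_sum : set T -> \bar R :=
  mscale (2^-1 : R)%:nng%R (measure_add P Q).

Lemma half_sumE A : half_sum A = (2^-1)%:E * (P A + Q A).
Proof. by congr (_ * _); exact: measure_addE. Qed.

HB.instance Definition _ := Measure.on half_sum.

Let half_sumT : half_sum setT = 1.
Proof. by rewrite half_sumE !probability_setT -EFinD -EFinM mulVf. Qed.

HB.instance Definition _ := Measure_isProbability.Build _ _ _
  half_sum half_sumT.

Lemma integral_half_sum (f : T -> \bar R) :
  measurable_fun setT f -> (forall x, 0 <= f x) ->
  \int[half_sum]_x f x = (2^-1)%:E * (\int[P]_x f x + \int[Q]_x f x).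
Proof.
move=> mf f0; rewrite ge0_integral_mscale//=.
by rewrite ge0_integral_measure_add.
Qed.

End half_sum.

Section swap_plan.
Context (R : realType) (mu : probability R R) (h : R).
Context (pi : probability (R * R)%type R) (E : set (R * R)).
Hypothesis mE : measurable E.

(** Off [E] the first point moves right and the second one moves left, as in the
    plan without exchange; on [E] their targets are exchanged. *)
Definition swap_right (z : R * R) : R * R :=
  if z \in E then (z.1, z.2 - h) else (z.1, z.1 + h).

Definition swap_left (z : R * R) : R * R :=
  if z \in E then (z.2, z.1 + h) else (z.2, z.2 - h).

Let measurable_affine (f : R * R -> R) (c : R) :
  measurable_fun setT f -> measurable_fun setT (fun z => f z + c).
Proof. by move=> mf; apply: measurable_funD. Qed.

Lemma measurable_swap_right : measurable_fun setT swap_right.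
Proof.
apply: measurable_fun_ifT.
- by apply: (measurable_fun_bool true); rewrite setTI preimage_mem_true.
- by apply: measurable_fun_pair => //=; apply: measurable_affine; exact: measurable_snd.
- by apply: measurable_fun_pair => //=; apply: measurable_affine; exact: measurable_fst.
Qed.

Lemma measurable_swap_left : measurable_fun setT swap_left.
Proof.
apply: measurable_fun_ifT.
- by apply: (measurable_fun_bool true); rewrite setTI preimage_mem_true.
- by apply: measurable_fun_pair => //=; apply: measurable_affine; exact: measurable_fst.
- by apply: measurable_fun_pair => //=; apply: measurable_affine; exact: measurable_snd.
Qed.

Let right_map : {mfun (R * R)%type >-> (R * R)%type} :=
  mfun_Sub (mem_set measurable_swap_right).
Let left_map : {mfun (R * R)%type >-> (R * R)%type} :=
  mfun_Sub (mem_set measurable_swap_left).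

Definition swap_plan : probability (R * R)%type R :=
  half_sum (distribution pi right_map) (distribution pi left_map).

Lemma swap_planE A : swap_plan A =
  ((2^-1)%:E * (pi (swap_right @^-1` A) + pi (swap_left @^-1` A)))%E.
Proof. exact: half_sumE. Qed.

(** The two maps always keep one coordinate as the source, whence the first
    marginal. For the second one, the targets are [Y - h] and [X + h] both on
    and off [E]; which of the two maps produces which depends on [E]. *)
Lemma swap_plan_coupling :
  is_coupling mu mu pi -> is_coupling mu (split_measure mu h) swap_plan.
Proof.
move=> cpi B mB; have [pi1 pi2] := cpi B mB.
have mf (f : R * R -> R) c : measurable_fun setT f ->
    measurable ((fun z => f z + c) @^-1` B).
  by move=> mf; rewrite -[X in measurable X]setTI; exact: measurable_affine.
split.
  rewrite /pushforward swap_planE.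
  transitivity ((2^-1)%:E * (pi (fst @^-1` B) + pi (snd @^-1` B)))%E.
    congr (_ * (pi _ + pi _))%E; apply/seteqP;
      by split=> z; rewrite /preimage /= /swap_right /swap_left; case: ifP.
  rewrite [pi _]pi1 [pi _]pi2.
  by rewrite -(fineK (fin_num_measure mu B mB)) -EFinD -EFinM; congr EFin; lra.
rewrite /pushforward swap_planE.
rewrite /split_measure; congr (_ * _)%E; rewrite /pushforward.
have mr := mf _ h measurable_fst; have ml := mf _ (- h) measurable_snd.
have /(_ _)/= := cpi ((fun x => x - h) @^-1` B).
have mt c : measurable ((fun x : R => x + c) @^-1` B).
  by rewrite -[X in measurable X]setTI; apply: measurable_funD.
move=> /(_ (mt _))[_ <-].
have [<- _] := cpi _ (mt h).
rewrite /pushforward.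
rewrite [X in _ = (X + _)%E](measureDI pi ml mE).
rewrite [X in _ = (_ + X)%E](measureDI pi mr mE).
have split_preimage (f : R * R -> R * R) (A A' : set (R * R)) :
    measurable A -> measurable A' ->
    f @^-1` (snd @^-1` B) = (A' `&` E) `|` (A `\` E) ->
    pi (f @^-1` (snd @^-1` B)) = (pi (A' `&` E) + pi (A `\` E))%E.
  move=> mA mA' ->; rewrite measureU//; [exact: measurableI|exact: measurableD|].
  by rewrite -subset0 => z [[_ Ez] [_ nEz]].
rewrite (@split_preimage _ _ _ mr ml); last first.
  apply/seteqP; split=> z; rewrite /preimage /= /swap_right; case: ifPn.
  - by rewrite inE; left.
  - by rewrite notin_setE; right.
  - by rewrite inE => Ez [[]|[]].
  - by rewrite notin_setE => Ez [[]|[]].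
rewrite (@split_preimage _ _ _ ml mr); last first.
  apply/seteqP; split=> z; rewrite /preimage /= /swap_left; case: ifPn.
  - by rewrite inE; left.
  - by rewrite notin_setE; right.
  - by rewrite inE => Ez [[]|[]].
  - by rewrite notin_setE => Ez [[]|[]].
by rewrite addeA addeC -!addeA.
Qed.

End swap_plan.

(** * Bounds on the Wasserstein distance from plans *)

Section wasserstein_bounds.
Context (R : realType).

Lemma measurable_cost (p : R) :
  measurable_fun setT (fun z : R * R => (`|z.1 - z.2| `^ p)%:E).
Proof.
apply/measurable_EFinP; apply: (measurableT_comp (measurable_powR p)).
by apply: measurableT_comp => //; apply: measurable_funB;
  [exact: measurable_fst|exact: measurable_snd].
Qed.

Lemma integral_two_levels_le d (T : measurableType d) (P : probability T R)
    (E : set T) (f : T -> \bar R) (b t : R) :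
  measurable E -> measurable_fun setT f -> 0 <= b -> t <= 1 ->
  (forall z, 0 <= f z)%E ->
  (forall z, E z -> f z <= (b * (1 - t))%:E)%E ->
  (forall z, ~ E z -> f z <= b%:E)%E ->
  (\int[P]_z f z <= (b * (1 - t * fine (P E)))%:E)%E.
Proof.
move=> mE mf b0 t1 f0 fE fnE.
have mnE := measurableC mE.
rewrite -(setUv E) ge0_integral_setU//; last 2 first.
- by rewrite setUv.
- by apply/disj_setPS; rewrite setICr.
have level (D : set T) c : measurable D -> 0 <= c ->
    (forall z, D z -> f z <= c%:E)%E ->
    (\int[P]_(z in D) f z <= c%:E * P D)%E.
  move=> mD c0 fD; rewrite -integral_cst//; apply: ge0_le_integral => //.
  exact: measurable_funTS.
apply: (le_trans (leeD (level E _ mE _ fE) (level _ _ mnE b0 fnE))).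
  by rewrite mulr_ge0 ?subr_ge0.
rewrite probability_setC// -(fineK (fin_num_measure P E mE)).
by rewrite -EFinB -!EFinM -EFinD lee_fin; lra.
Qed.

(** The pairs for which an exchange saves at least the fraction [t] of the
    distance [h]. *)
Definition forward_pairs (t h : R) : set (R * R) :=
  [set z | t * h <= z.2 - z.1 <= h].

Lemma measurable_forward_pairs t h : measurable (forward_pairs t h).
Proof.
have msub : measurable_fun setT (fun z : R * R => z.2 - z.1).
  by apply: measurable_funB; [exact: measurable_snd|exact: measurable_fst].
have -> : forward_pairs t h = (fun z : R * R => z.2 - z.1) @^-1` `[t * h, h].
  by apply/seteqP; split=> z; rewrite /preimage /= in_itv.
by rewrite -[X in measurable X]setTI; exact: msub.
Qed.

(** An exchanged pair travels [h - (Y - X)], at most [(1 - t) h], and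
    [(1 - t) ^ p <= 1 - t] because [p >= 1]; all others travel [h]. With [t = 0]
    this is the bound [W_p <= h]. *)
Lemma Wasserstein_swap_le (mu : probability R R)
    (pi : probability (R * R)%type R) (p t h : R) :
  1 <= p -> 0 <= t < 1 -> 0 < h -> is_coupling mu mu pi ->
  (Wasserstein p mu (split_measure mu h) <=
   ((1 - t * fine (pi (forward_pairs t h))) `^ p^-1 * h)%:E)%E.
Proof.
move=> p1 /andP[t0 t1] h0 cpi.
have p0 : 0 < p by apply: lt_le_trans p1.
have mE := measurable_forward_pairs t h.
set E := forward_pairs t h; set q := 1 - t * fine (pi E).
have q0 : 0 <= q.
  rewrite subr_ge0; apply: mulr_ile1 => //; [exact/fine_ge0/measure_ge0|exact: ltW|].
  rewrite -lee_fin fineK ?fin_num_measure//.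
  exact: probability_le1.
have hp : h `^ p * q = (q `^ p^-1 * h) `^ p.
  by rewrite powRM ?powR_ge0 ?ltW// -powRrM mulVf ?gt_eqF// powRr1// mulrC.
have cost_le (f : R * R -> R * R) : measurable_fun setT f ->
    (forall z, E z -> `|(f z).1 - (f z).2| <= h * (1 - t)) ->
    (forall z, ~ E z -> `|(f z).1 - (f z).2| <= h) ->
    (\int[pi]_z (`|(f z).1 - (f z).2| `^ p)%:E <= (h `^ p * q)%:E)%E.
  move=> mf fE fnE; apply: integral_two_levels_le => //.
  - exact: (measurableT_comp (measurable_cost p) mf).
  - exact: powR_ge0.
  - exact: ltW.
  - move=> z Ez; rewrite /= lee_fin.
    apply: (@le_trans _ _ ((h * (1 - t)) `^ p)).
      by rewrite ge0_ler_powR ?fE// ?nnegrE ?mulr_ge0 ?subr_ge0// ltW.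
    rewrite powRM ?subr_ge0 ?(ltW h0) ?(ltW t1)//; apply: ler_wpM2l; first exact: powR_ge0.
    by apply: ge1r_powR => //; rewrite subr_gt0 t1 gerBl.
  - move=> z Ez; rewrite /= lee_fin.
    by rewrite ge0_ler_powR ?fnE ?nnegrE// ltW.
have costE : (transport_cost p (swap_plan h pi mE) <= (h `^ p * q)%:E)%E.
  rewrite /transport_cost integral_half_sum//; last exact: measurable_cost.
  rewrite !ge0_integral_distribution//; try exact: measurable_cost.
  rewrite /comp /=.
  have -> : (h `^ p * q)%:E = ((2^-1)%:E * ((h `^ p * q)%:E + (h `^ p * q)%:E))%E.
    by rewrite -EFinD -EFinM; congr EFin; lra.
  rewrite lee_pmul2l//; apply: leeD; apply: cost_le.
  - exact: measurable_swap_right.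
  - move=> z Ez; rewrite /swap_right mem_set//=.
    by move: Ez => /andP[]; rewrite ler_norml; lra.
  - move=> z nEz; rewrite /swap_right memNset//=.
    by rewrite ler_norml; lra.
  - exact: measurable_swap_left.
  - move=> z Ez; rewrite /swap_left mem_set//=.
    by move: Ez => /andP[]; rewrite ler_norml; lra.
  - move=> z nEz; rewrite /swap_left memNset//=.
    by rewrite ler_norml; lra.
have -> : ((q `^ p^-1 * h)%:E = (h `^ p * q)%:E `^ p^-1)%E.
  rewrite poweR_EFin hp -powRrM mulfV ?gt_eqF// powRr1// mulr_ge0 ?powR_ge0 ?ltW//.
rewrite /Wasserstein; apply: gt0_ler_poweR.
- by rewrite invr_ge0 ltW.
- rewrite in_itv /= leey andbT; apply: le_ereal_inf_tmp => _ [eta _ <-].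
  by apply: integral_ge0 => z _; rewrite lee_fin powR_ge0.
- by rewrite in_itv /= leey andbT lee_fin mulr_ge0 ?powR_ge0.
apply: ge_ereal_inf; exists (transport_cost p (swap_plan h pi mE)) => //.
by exists (swap_plan h pi mE) => //; exact: swap_plan_coupling.
Qed.

(** Markov's inequality for the cost, the form in which every plan is bounded
    from below. *)
Lemma transport_cost_ge (eta : probability (R * R)%type R) (D : set (R * R))
    (p r : R) :
  measurable D -> 0 <= r -> 0 <= p -> (forall z, D z -> r <= `|z.1 - z.2|) ->
  ((r `^ p)%:E * eta D <= transport_cost p eta)%E.
Proof.
move=> mD r0 p0 rD; rewrite -integral_cst//.
apply: (@le_trans _ _ (\int[eta]_(z in D) (`|z.1 - z.2| `^ p)%:E)%E).
  apply: ge0_le_integral => //.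
  - by move=> z _; rewrite lee_fin powR_ge0.
  - exact: measurable_funTS (measurable_cost p).
  - by move=> z Dz; rewrite lee_fin ge0_ler_powR ?nnegrE ?rD.
by apply: ge0_subset_integral => //; exact: measurable_cost.
Qed.

End wasserstein_bounds.

(** * The coupling that resamples a point within its cell *)

Section cellwise.
Context d (T : measurableType d) (R : realType) (mu : probability T R).
Context (k : {mfun T >-> nat}).

Definition cell (n : nat) : set T := k @^-1` [set n].

Lemma measurable_cell n : measurable (cell n).
Proof. exact: measurable_funPTI. Qed.

Lemma measure_cells (A : set T) :
  measurable A -> mu A = (\sum_(n <oo) mu (A `&` cell n))%E.
Proof.
move=> mA; have AE : A = \bigcup_n (A `&` cell n).
  by rewrite -setI_bigcupr; apply/seteqP; split=> [x Ax|x []//]; split=> //;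
    exists (k x).
rewrite [in LHS]AE measure_semi_bigcup//.
- by move=> n; apply: measurableI => //; exact: measurable_cell.
- apply: trivIset_setIl; apply/trivIsetP => i j _ _ /eqP ij.
  by rewrite -subset0 => x [xi xj]; apply: ij; rewrite -xi -xj.
- rewrite -AE//.
Qed.

Let square n : measurable (cell n `*` cell n).
Proof. by apply: measurableX; exact: measurable_cell. Qed.

Let weight n : {nonneg R} :=
  NngNum (eqbRL (invr_ge0 _) (fine_ge0 (measure_ge0 mu (cell n)))).

(** The law of [(X, Y)] where [X] has law [mu] and, given [X], [Y] is drawn from
    [mu] conditioned on the cell of [X]. A cell of mass zero gets the weight
    [0^-1 = 0], which is harmless as it carries no mass. *)
Definition cellwise_product : set (T * T) -> \bar R :=
  mseries (fun n => mscale (weight n) (mrestr (mu \x mu)%E (square n))) 0.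

HB.instance Definition _ := Measure.on cellwise_product.

Lemma cellwise_productE (B : set (T * T)) : cellwise_product B =
  (\sum_(n <oo) ((fine (mu (cell n)))^-1)%:E *
     (mu \x mu) (B `&` (cell n `*` cell n)))%E.
Proof. by []. Qed.

Lemma cellwise_product_rect (A B : set T) : measurable A -> measurable B ->
  cellwise_product (A `*` B) =
  (\sum_(n <oo) ((fine (mu (cell n)))^-1)%:E *
     (mu (A `&` cell n) * mu (B `&` cell n)))%E.
Proof.
move=> mA mB; rewrite cellwise_productE; apply: eq_eseriesr => n _.
have mc := measurable_cell n.
by rewrite -setXI product_measure1E//; exact: measurableI.
Qed.

Let cancel_weight (A : set T) n : measurable A ->
  (((fine (mu (cell n)))^-1)%:E * (mu (A `&` cell n) * mu (cell n)) =
   mu (A `&` cell n))%E.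
Proof.
move=> mA; have mc := measurable_cell n; have mAc := measurableI _ _ mA mc.
rewrite -{2}(fineK (fin_num_measure mu _ mc)).
rewrite -(fineK (fin_num_measure mu _ mAc)) -!EFinM; congr EFin.
have [m0|m0] := eqVneq (fine (mu (cell n))) 0; last by rewrite mulrC mulfK.
rewrite m0 mulr0 mulr0; apply/esym/eqP; rewrite eq_le fine_ge0// andbT.
by rewrite -m0 fine_le ?fin_num_measure// le_measure ?inE//; exact: subIsetr.
Qed.

Lemma cellwise_product_fst (A : set T) : measurable A ->
  cellwise_product (A `*` setT) = mu A.
Proof.
move=> mA; rewrite cellwise_product_rect// measure_cells//.
by apply: eq_eseriesr => n _; rewrite setTI cancel_weight.
Qed.

Lemma cellwise_product_snd (A : set T) : measurable A ->
  cellwise_product (setT `*` A) = mu A.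
Proof.
move=> mA; rewrite cellwise_product_rect// measure_cells//.
by apply: eq_eseriesr => n _; rewrite setTI [X in (_ * X)%E]muleC cancel_weight.
Qed.

Let cellwise_productT : cellwise_product setT = 1%E.
Proof. by rewrite -setXTT cellwise_product_fst// probability_setT. Qed.

HB.instance Definition _ := Measure_isProbability.Build _ _ _
  cellwise_product cellwise_productT.

(** With [S] a set of pairs of distant points, these are the points near which
    more than half of the mass of their cell is found. *)
Definition concentrated (S : set (T * T)) : set T :=
  [set x | mu (xsection S x `&` cell (k x)) < (2^-1)%:E * mu (cell (k x))]%E.

Let measurable_deficit (S : set (T * T)) n : measurable S ->
  measurable_fun setT (fun x => mu (xsection S x `&` cell n)).
Proof.
move=> mS; have mSn : measurable (S `&` (setT `*` cell n)).
  by apply: measurableI => //; apply: measurableX => //; exact: measurable_cell.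
rewrite (_ : (fun x => _) = (mu \o xsection (S `&` (setT `*` cell n)))).
  exact: measurable_fun_xsection.
by apply/funext => x /=; rewrite setTX xsectionI xsection_preimage_snd.
Qed.

Lemma measurable_concentrated S : measurable S -> measurable (concentrated S).
Proof.
move=> mS; have -> : concentrated S = \bigcup_n (cell n `&`
    [set x | mu (xsection S x `&` cell n) < (2^-1)%:E * mu (cell n)]%E).
  apply/seteqP; split=> [x Sx|x [n _ [/= <-]]//].
  by exists (k x).
apply: bigcup_measurable => n _; apply: measurableI.
  exact: measurable_cell.
rewrite -[X in measurable X]setTI; apply: emeasurable_fun_infty_o => //.
exact: measurable_deficit.
Qed.

(** Markov's inequality for the conditional probability, given [X], that
    [(X, Y)] falls in [S]: in a cell of positive mass, a point outside
    [concentrated S] sees [S] with probability at least one half. *)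
Lemma concentratedC_le S : measurable S ->
  (mu (~` concentrated S) <= 2%:E * cellwise_product S)%E.
Proof.
move=> mS; have mC := measurableC (measurable_concentrated mS).
rewrite measure_cells// cellwise_productE -nneseriesZl//; last first.
  by move=> n _; rewrite mule_ge0// lee_fin invr_ge0 fine_ge0.
apply: lee_nneseries => // n _.
set m := mu (cell n); have mc := measurable_cell n.
have mfin : m \is a fin_num by exact: fin_num_measure.
have [m0|m0] := eqVneq (fine m) 0.
  rewrite m0 invr0 mul0e mule0 -[leRHS](_ : m = 0)%E ?le_measure ?inE//.
  - exact: measurableI.
  - by rewrite -(fineK mfin) m0.
have mpos : 0 < fine m by rewrite lt_neqAle eq_sym m0 fine_ge0// measure_ge0.
set B := ~` concentrated S `&` cell n.
have mB : measurable B by exact: measurableI.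
(* Clearing the weight: with [m] the mass of the cell [K], it remains to bound
   [m / 2 * mu B] by the mass of the part of [S] inside [K x K]. *)
rewrite muleA -(@lee_pmul2l _ (2^-1 * fine m)%:E)//; last by rewrite lte_fin mulr_gt0.
rewrite muleA -!EFinM (_ : 2^-1 * fine m * (2 * (fine m)^-1) = 1); last by field.
rewrite mul1e.
rewrite -integral_cst//.
rewrite /product_measure1.
apply: (@le_trans _ _ (\int[mu]_(x in B) mu (xsection (S `&` (cell n `*` cell n)) x))%E).
  apply: ge0_le_integral => //.
  - by move=> x _; rewrite /cst /= lee_fin mulr_ge0 ?ltW.
  - apply: measurable_funTS; apply: measurable_fun_xsection.
    exact: measurableI.
  - move=> x [/= nSx kx].
    rewrite /cst xsectionI in_xsectionX; last by rewrite inE.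
    move/negP: nSx; rewrite -leNgt kx EFinM.
    by rewrite [(fine m)%:E](fineK mfin).
apply: ge0_subset_integral => //.
by apply: measurable_fun_xsection; exact: measurableI.
Qed.

End cellwise.

(** * Clusters at a single scale *)

Section grid.
Context (R : realType) (h c : R).

(** Cells are numbered by naturals, through an encoding of the integers, so that
    sums over cells are series. *)
Definition grid_index (x : R) : nat := pickle (Num.floor (x / h + c)).

Lemma measurable_grid_index : measurable_fun setT grid_index.
Proof.
move=> _ Y _; rewrite setTI.
have -> : grid_index @^-1` Y = \bigcup_(z in [set z : int | Y (pickle z)])
    (fun x => x / h + c) @^-1` `[z%:~R, (z + 1)%:~R[.
  apply/seteqP; split=> [x Yx|x [z Yz]].
    exists (Num.floor (x / h + c)) => //.
    by rewrite /preimage /= in_itv /= floor_itv.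
  rewrite /preimage /= in_itv /= -floor_eq => /eqP zE.
  by rewrite /grid_index zE.
rewrite bigcup_mkcond; apply: countable_bigcupT_measurable => // z.
case: ifP => // _.
rewrite -[X in measurable X]setTI.
have maff : measurable_fun setT (fun x : R => x / h + c).
  by apply: measurable_funD => //; apply: measurable_funM.
exact: maff.
Qed.

HB.instance Definition _ :=
  isMeasurableFun.Build _ _ _ _ grid_index measurable_grid_index.

Lemma same_cell_dist x y : 0 < h -> grid_index x = grid_index y -> `|x - y| < h.
Proof.
move=> h0 /(pcan_inj pickleK) /eqP; rewrite floor_eq => /andP[].
have := floor_itv (y / h + c) => /andP[].
set z := Num.floor _; rewrite intrD => y1 y2 x1 x2.
rewrite -(ltr_pM2r (_ : 0 < h^-1)) ?invr_gt0// divff ?gt_eqF//.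
rewrite -[h^-1]gtr0_norm ?invr_gt0// -normrM mulrBl.
by rewrite ltr_norml; lra.
Qed.

End grid.

(** A boundary of the grid with offset [1/2] is at distance at least [h / 2]
    from the boundaries of the grid with offset [0], so that an interval of
    length less than [h / 2] cannot meet boundaries of both. *)
Lemma close_same_cell (R : realType) (h x y : R) : 0 < h -> `|x - y| < h / 2 ->
  grid_index h 0 x = grid_index h 0 y \/
  grid_index h 2^-1 x = grid_index h 2^-1 y.
Proof.
move=> h0; wlog xy : x y / x <= y => [wl|].
  move=> d; have [xy|/ltW yx] := leP x y; first exact: wl.
  by rewrite distrC in d; case: (wl _ _ yx d) => ->; [left|right].
rewrite distrC ger0_norm ?subr_ge0// => d.
have {}d : y / h - x / h < 2^-1.
  rewrite -(ltr_pM2r (_ : 0 < h^-1)) ?invr_gt0// in d.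
  by move: d; rewrite mulrBl mulrAC divff ?gt_eqF// mul1r.
have {}xy : x / h <= y / h by rewrite ler_pM2r ?invr_gt0.
rewrite /grid_index !addr0; move: (x / h) (y / h) d xy => u v d uv.
have /andP[u1 u2] := floor_itv u.
have [v2|v2] := ltP v ((Num.floor u + 1)%:~R).
  left; congr pickle; apply/esym/eqP; rewrite floor_eq v2 andbT.
  exact: le_trans uv.
right; congr pickle; transitivity (Num.floor u + 1).
  apply/eqP; rewrite floor_eq; move: u1 u2 v2; rewrite !intrD; lra.
apply/esym/eqP; rewrite floor_eq; move: u1 u2 v2; rewrite !intrD; lra.
Qed.

Section clusters.
Context (R : realType) (mu : probability R R).

Lemma cellwise_coupling (k : {mfun R >-> nat}) :
  is_coupling mu mu (cellwise_product mu k).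
Proof.
move=> B mB; split; rewrite /pushforward.
  by rewrite -setXT; exact: cellwise_product_fst.
by rewrite -setTX; exact: cellwise_product_snd.
Qed.

Lemma measurable_pair_swap : measurable_fun setT (fun z : R * R => (z.2, z.1)).
Proof.
by apply: measurable_fun_pair; [exact: measurable_snd|exact: measurable_fst].
Qed.

Let pair_swap : {mfun (R * R)%type >-> (R * R)%type} :=
  mfun_Sub (mem_set measurable_pair_swap).

Definition distant_pairs (t h : R) : set (R * R) :=
  [set z | t * h <= `|z.1 - z.2| <= h].

Lemma distant_pairsE t h : 0 <= t -> 0 <= h -> distant_pairs t h =
  forward_pairs t h `|` pair_swap @^-1` forward_pairs t h.
Proof.
move=> t0 h0; have th := mulr_ge0 t0 h0.
apply/seteqP; split=> z; rewrite /distant_pairs /forward_pairs /preimage /=.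
  have [zz|/ltW zz] := leP z.1 z.2.
    by rewrite ler0_norm ?subr_le0// opprB; left.
  by rewrite ger0_norm ?subr_ge0//; right.
case=> /andP[z1 z2].
  by rewrite ler0_norm ?opprB ?z1// subr_le0 -subr_ge0 (le_trans th).
by rewrite ger0_norm ?z1// (le_trans th).
Qed.

Lemma measurable_distant_pairs t h : 0 <= t -> 0 <= h ->
  measurable (distant_pairs t h).
Proof.
move=> t0 h0; rewrite distant_pairsE//.
have mE := measurable_forward_pairs t h.
by apply: measurableU => //; exact: measurable_funPTI.
Qed.

(** Read contrapositively: a self-coupling charging these pairs with more than
    [b] would give a plan too cheap for the assumed lower bound on [W_p]. *)
Lemma forward_pairs_le (pi : probability (R * R)%type R) (p t h b : R) :
  1 <= p -> 0 < t < 1 -> 0 < h -> t * b <= 1 -> is_coupling mu mu pi ->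
  (((1 - t * b) `^ p^-1 * h)%:E < Wasserstein p mu (split_measure mu h))%E ->
  (pi (forward_pairs t h) <= b%:E)%E.
Proof.
move=> p1 /andP[t0 t1] h0 b1 cpi W.
have t01 : 0 <= t < 1 by rewrite ltW.
have /(lt_le_trans W) := Wasserstein_swap_le p1 t01 h0 cpi.
rewrite lte_fin ltr_pM2r// => q.
have mE := measurable_forward_pairs t h.
rewrite -(fineK (fin_num_measure pi _ mE)) lee_fin leNgt; apply/negP => bE.
move: q; rewrite ltNge => /negP; apply.
apply: ge0_ler_powR.
- by rewrite invr_ge0 (le_trans _ p1).
- rewrite nnegrE subr_ge0; apply: mulr_ile1; rewrite ?(ltW t0) ?(ltW t1)//.
    by rewrite fine_ge0// measure_ge0.
  by rewrite -lee_fin fineK ?fin_num_measure//; exact: probability_le1.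
- by rewrite nnegrE subr_ge0.
- by rewrite lerD2l lerN2 ler_pM2l// ltW.
Qed.

(** The previous bound, applied to the coupling and to its transpose, controls
    both orders of the pair. *)
Lemma distant_pairs_le (pi : probability (R * R)%type R) (p t h b : R) :
  1 <= p -> 0 < t < 1 -> 0 < h -> t * b <= 1 -> is_coupling mu mu pi ->
  (((1 - t * b) `^ p^-1 * h)%:E < Wasserstein p mu (split_measure mu h))%E ->
  (pi (distant_pairs t h) <= (2 * b)%:E)%E.
Proof.
move=> p1 t01 h0 b1 cpi W; have /andP[t0 t1] := t01.
have mE := measurable_forward_pairs t h.
rewrite distant_pairsE ?(ltW t0) ?(ltW h0)//.
have mE' : measurable (pair_swap @^-1` forward_pairs t h).
  exact: measurable_funPTI.
apply: (le_trans (measureU2 pi mE mE')).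
rewrite (_ : 2 * b = b + b); last by lra.
rewrite EFinD; apply: leeD; first exact: (forward_pairs_le p1 t01 h0 b1 cpi W).
pose pi' : probability (R * R)%type R := distribution pi pair_swap.
apply: (@forward_pairs_le pi' p t h b p1 t01 h0 b1 _ W) => B mB.
by have [? ?] := cpi B mB.
Qed.

(** If [x] and [y] were [2 t h] apart, every point of their cell would be at
    distance at least [t h] from one of them, and two sets of less than half the
    mass of the cell would cover it. *)
Lemma concentrated_dist (k : {mfun R >-> nat}) (t h x y : R) :
  0 <= t -> 0 <= h ->
  (forall u v, k u = k v -> `|u - v| <= h) ->
  concentrated mu k (distant_pairs t h) x ->
  concentrated mu k (distant_pairs t h) y ->
  k x = k y -> `|x - y| < 2 * t * h.
Proof.
move=> t0 h0 kh; rewrite /concentrated /= => Gx Gy kxy.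
rewrite ltNge; apply/negP => d.
set K := cell k (k x) in Gx; rewrite -kxy -/K in Gy.
have mK : measurable K by exact: measurable_cell.
have mS := measurable_distant_pairs t0 h0.
have mSx z : measurable (xsection (distant_pairs t h) z `&` K).
  by apply: measurableI => //; exact: measurable_xsection.
have : (mu K < mu K)%E; last by rewrite ltxx.
have half : (mu K = (2^-1)%:E * mu K + (2^-1)%:E * mu K)%E.
  rewrite -(fineK (fin_num_measure mu _ mK)) -!EFinM -EFinD; congr EFin; lra.
rewrite [ltRHS]half; apply: le_lt_trans (lteD Gx Gy).
apply: (le_trans _ (measureU2 mu (mSx x) (mSx y))).
apply: le_measure; rewrite ?inE//; first exact: measurableU.
move=> w Kw; have xw : `|x - w| <= h by apply: kh; rewrite Kw.
have yw : `|y - w| <= h by apply: kh; rewrite -kxy Kw.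
have [dx|dx] := leP (t * h) `|x - w|; [left|right]; split=> //.
  by rewrite /xsection /= inE /distant_pairs /= dx.
rewrite /xsection /= inE /distant_pairs /= yw andbT.
have := ler_distD w x y; rewrite (distrC w y) => tri; lra.
Qed.

(** One grid with offset [0] and one with offset [1/2]: each loses mass [4 b],
    and each close pair is seen by one of them. *)
Lemma cluster_decomposition (p t h b : R) :
  1 <= p -> 0 < t < 1 -> 0 < h -> t * b <= 1 ->
  (((1 - t * b) `^ p^-1 * h)%:E < Wasserstein p mu (split_measure mu h))%E ->
  exists A : set R, [/\ measurable A, (mu (~` A) <= (8 * b)%:E)%E &
    forall x y, A x -> A y -> `|x - y| < h / 2 -> `|x - y| < 2 * t * h].
Proof.
move=> p1 t01 h0 b1 W; have /andP[/ltW t0 t1] := t01.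
have mS := measurable_distant_pairs t0 (ltW h0).
pose G c := concentrated mu (grid_index h c) (distant_pairs t h).
have mG c : measurable (G c) by exact: measurable_concentrated.
have muG c : (mu (~` G c) <= (4 * b)%:E)%E.
  apply: (le_trans (concentratedC_le _ _ mS)).
  rewrite (_ : 4 * b = 2 * (2 * b)); last by lra.
  rewrite [leRHS]EFinM lee_pmul2l//.
  exact: (distant_pairs_le p1 t01 h0 b1 (cellwise_coupling _) W).
exists (G 0 `&` G 2^-1); split; first exact: measurableI.
  have mGC c := measurableC (mG c).
  rewrite setCI; apply: (le_trans (measureU2 mu (mGC _) (mGC _))).
  rewrite (_ : 8 * b = 4 * b + 4 * b); last by lra.
  by rewrite EFinD; apply: leeD; exact: muG.
move=> x y [Gx Gx'] [Gy Gy'] d.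
have kh c u v : grid_index h c u = grid_index h c v -> `|u - v| <= h.
  by move=> /(same_cell_dist h0) /ltW.
by case: (close_same_cell h0 d) => e;
  [apply: (concentrated_dist t0 (ltW h0) (@kh _) Gx Gy)
  |apply: (concentrated_dist t0 (ltW h0) (@kh _) Gx' Gy')].
Qed.

End clusters.

(** * Sharp rate and the class of clustered sets *)

Section limsup.
Context (R : realType).

Lemma limf_esup_right_gt (f : R -> \bar R) (r : \bar R) :
  (r < limf_esup f (0 : R)^'+)%E ->
  forall e : R, 0 < e -> exists2 h, 0 < h < e & (r < f h)%E.
Proof.
move=> rf e e0; have : (r < ereal_sup (f @` [set h | (0 < h < e)%R]))%E.
  apply: (lt_le_trans rf); apply: ereal_inf_lbound; exists [set h | 0 < h < e] => //.
  near=> h; apply/andP; split; near: h; [exact: nbhs_right_gt|exact: nbhs_right_lt].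
by move=> /ereal_sup_gt[_ [h he <-] rh]; exists h.
Unshelve. all: by end_near. Qed.

Lemma limf_esup_right_ge (f : R -> \bar R) (r : \bar R) :
  (forall e : R, 0 < e -> exists2 h, 0 < h < e & (r <= f h)%E) ->
  (r <= limf_esup f (0 : R)^'+)%E.
Proof.
move=> rf; apply: le_ereal_inf_tmp => _ [V V0 <-].
have [e e0 eV] : exists2 e : R, 0 < e & forall h, 0 < h < e -> V h.
  move: V0 => [e /= e0 eV]; exists e => // h /andP[h0 he]; apply: eV => //.
  by rewrite /ball_ /= sub0r normrN gtr0_norm.
have [h he rh] := rf _ e0.
by apply: (le_trans rh); apply: ereal_sup_ubound; exists h => //; exact: eV.
Qed.

End limsup.

Section rate.
Context (R : realType) (mu : probability R R).

Let rate p h := (Wasserstein p mu (split_measure mu h) * (h^-1)%:E)%E.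

Lemma Wasserstein_split_le p h : 1 <= p -> 0 < h ->
  (Wasserstein p mu (split_measure mu h) <= h%:E)%E.
Proof.
move=> p1 h0; have := @Wasserstein_swap_le _ _ _ p 0 h p1 _ h0
  (cellwise_coupling mu (grid_index 1 0)).
by rewrite lexx ltr01 mul0r subr0 powR1 mul1r; exact.
Qed.

(** The upper bound [W_p <= h] always holds, so that only arbitrarily small
    scales with [W_p] close to [h] have to be exhibited. *)
Lemma sharp_rate_lower p : 1 <= p ->
  (forall d e : R, 0 < d < 1 -> 0 < e -> exists2 h, 0 < h < e &
    ((d * h)%:E <= Wasserstein p mu (split_measure mu h))%E) ->
  sharp_rate mu p.
Proof.
move=> p1 low; apply/eqP; rewrite eq_le; apply/andP; split.
  apply: ge_ereal_inf; exists (ereal_sup [set rate p h | h in [set h | 0 < h]]).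
    exists [set h | 0 < h] => //.
    by near=> h; near: h; exact: nbhs_right_gt.
  apply: ge_ereal_sup => _ [h /= h0 <-].
  by rewrite lee_pdivrMr// mul1e Wasserstein_split_le.
apply/lee_subgt0Pr => e e0; apply: limf_esup_right_ge => r r0.
(* The maximum keeps [d] positive when [e >= 1]. *)
pose d := Num.max 2^-1 (1 - e).
have d01 : 0 < d < 1 by rewrite lt_max gt_max; lra.
have [h hr dh] := low d r d01 r0; exists h => //.
have /andP[h0 _] := hr.
apply: (@le_trans _ _ d%:E).
  by rewrite -EFinB lee_fin le_max lexx orbT.
by rewrite lee_pdivlMr.
Unshelve. all: by end_near. Qed.

End rate.

Section concentrated_to_sharp.
Context (R : realType) (mu : probability R R).

(** All that is used of the class: arbitrarily small scales at which close
    points are very close. *)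
Lemma classA_scale (A : set R) (t e : R) : classA A -> 0 < t -> 0 < e ->
  exists2 s, 0 < s < e &
    forall x y, A x -> A y -> `|x - y| < s -> `|x - y| <= t * s.
Proof.
move=> [_ [s [s01 s0 supA]]] t0 e0.
have [n [sne supn]] : exists n, s n < e /\
    (ereal_sup [set local_radius A (s n) x | x in A] < t%:E)%E.
  apply: (@filter_ex _ (\oo : set_system nat)) => //.
  near=> n; split; near: n.
    by apply: cvgr_lt; [exact: s0|].
  exact: (supA _ (open_ereal_lt' _)).
exists (s n) => [|x y Ax Ay xy]; first by case/andP: (s01 n) => -> _.
have sn0 : 0 < s n by case/andP: (s01 n).
have : (local_radius A (s n) x < t%:E)%E.
  by apply: le_lt_trans supn; apply: ereal_sup_ubound; exists x.
move=> /ereal_inf_lt[_ [r [/andP[r0 r1] Ar] <-]]; rewrite lte_fin => rt.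
have /Ar : (ball x (s n) `&` A) y by split => //; rewrite -ball_normE.
rewrite closed_ballE ?mulr_gt0// /closed_ball_ /= => /le_trans; apply.
by rewrite ler_pM2r// ltW.
Unshelve. all: by end_near. Qed.

(** A point of [A] sent to [B = (A + h) U (A - h)] travels at least [d h], and a
    plan does so on mass at least [1 - 2 e] since [A] has mass at least [1 - e]
    for the first marginal and so does [B] for the second one. The bound
    [d ^ p <= 1 - 2 e] on the lost mass costs one more factor [d]. *)
Lemma Wasserstein_split_ge (A : set R) (p h d e : R) : 1 <= p -> 0 < h ->
  0 < d < 1 -> d `^ p <= 1 - 2 * e -> measurable A ->
  ((1 - e)%:E <= mu A)%E ->
  (forall x y, A x -> A y -> `|x - y| < 2 * h -> `|x - y| <= (1 - d) * h) ->
  ((d * (d * h))%:E <= Wasserstein p mu (split_measure mu h))%E.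
Proof.
move=> p1 h0 /andP[d0 d1] de mA muA gapA.
have p0 : 0 < p by apply: lt_le_trans p1.
have dh0 : 0 <= d * h by rewrite mulr_ge0 ?ltW.
have nA : (mu (~` A) <= e%:E)%E.
  rewrite probability_setC//; move: muA.
  rewrite -(fineK (fin_num_measure mu _ mA)) -EFinB !lee_fin; lra.
pose B : set R := [set y | A (y - h) \/ A (y + h)].
have mt (C : set R) c : measurable C -> measurable ((fun x : R => x + c) @^-1` C).
  by move=> mC; rewrite -[X in measurable X]setTI; apply: measurable_funD.
have mB : measurable B by apply: measurableU; exact: mt.
have nB : (split_measure mu h (~` B) <= e%:E)%E.
  rewrite /split_measure /pushforward.
  have mnB := measurableC mB; have mnA := measurableC mA.
  rewrite (_ : e%:E = ((2^-1)%:E * (e%:E + e%:E))%E); last first.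
    by rewrite -EFinD -EFinM; congr EFin; lra.
  rewrite lee_pmul2l//; apply: leeD; apply: le_trans nA;
    (apply: le_measure; rewrite ?inE//; first exact: mt) => x nBx Ax;
    by apply: nBx; rewrite /B /= ?subrK ?addrK; auto.
pose D : set (R * R) := A `*` B.
have mD : measurable D by exact: measurableX.
have farD z : D z -> d * h <= `|z.1 - z.2|.
  case: z => x y [/= Ax By].
  have far a : A a -> `|a - y| = h -> d * h <= `|x - y|.
    move=> Aa ay; have := ler_distD y x a; rewrite (distrC y a) ay.
    have := ler_distD x a y; rewrite (distrC a x) ay.
    have dh : d * h <= h by rewrite ler_piMl ?ltW.
    have [xa|xa] := ltP `|x - a| (2 * h); last by lra.
    by have := gapA _ _ Ax Aa xa; lra.
  (* The point [a] of [A] at distance [h] from [y] is [y - h] or [y + h]. *)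
  case: By => [/far|/far]; apply.
    by rewrite addrAC subrr sub0r normrN gtr0_norm.
  by rewrite addrAC subrr add0r gtr0_norm.
rewrite /Wasserstein.
have -> : ((d * (d * h))%:E = ((d * (d * h)) `^ p)%:E `^ p^-1)%E.
  rewrite poweR_EFin -powRrM mulfV ?gt_eqF// powRr1// mulr_ge0 ?ltW//.
  by rewrite mulr_gt0.
have cost eta : is_coupling mu (split_measure mu h) eta ->
    (((d * (d * h)) `^ p)%:E <= transport_cost p eta)%E.
  move=> ceta; apply: le_trans (transport_cost_ge eta mD dh0 (ltW p0) farD).
  rewrite powRM ?(ltW d0)// mulrC EFinM lee_pmul2l ?lte_fin ?powR_gt0 ?mulr_gt0//.
  have mnD := measurableC mD.
  have : (eta (~` D) <= (2 * e)%:E)%E.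
    have mnA := measurableC mA; have mnB := measurableC mB.
    have [etaA _] := ceta _ mnA; have [_ etaB] := ceta _ mnB.
    have mAT : measurable (~` A `*` (setT : set R)) by exact: measurableX.
    have mTB : measurable ((setT : set R) `*` ~` B) by exact: measurableX.
    apply: (@le_trans _ _ (eta ((~` A `*` setT) `|` (setT `*` ~` B)))).
      apply: le_measure; rewrite ?inE//; first exact: measurableU.
      case=> x y /= nD; have [Ax|nAx] := pselect (A x); last by left.
      by right; split=> // By; apply: nD.
    apply: (le_trans (measureU2 eta mAT mTB)).
    rewrite (_ : 2 * e = e + e); last by lra.
    rewrite EFinD; apply: leeD.
      by move: nA; rewrite setXT -etaA.
    by move: nB; rewrite setTX -etaB.
  rewrite probability_setC// -(fineK (fin_num_measure eta _ mD)) -EFinB !lee_fin.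
  by move: de; lra.
apply: gt0_ler_poweR.
- by rewrite invr_ge0 ltW.
- by rewrite in_itv /= leey andbT lee_fin powR_ge0.
- rewrite in_itv /= leey andbT; apply: le_ereal_inf_tmp => _ [eta _ <-].
  by apply: integral_ge0 => z _; rewrite lee_fin powR_ge0.
by apply: le_ereal_inf_tmp => _ [eta ceta <-]; exact: cost.
Qed.

Lemma sharp_rate_of_classA (p : R) : 1 <= p ->
  (forall eps : R, 0 < eps ->
    exists2 A : set R, classA A & ((1 - eps)%:E <= mu A)%E) ->
  sharp_rate mu p.
Proof.
move=> p1 conc; apply: sharp_rate_lower => // c r /andP[c0 c1] r0.
have p0 : 0 < p by apply: lt_le_trans p1.
(* One factor [d] for the distances and one for the masses: [c <= d ^ 2]. *)
pose d := (1 + c) / 2.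
have d01 : 0 < d < 1 by rewrite /d; lra.
have /andP[d0 d1] := d01.
have cdd : c <= d * d by rewrite /d; nra.
pose e := (1 - d `^ p) / 2.
have e0 : 0 < e.
  have : d `^ p < 1 `^ p by rewrite gt0_ltr_powR ?nnegrE// ltW.
  by rewrite powR1 /e; lra.
have [A cA muA] := conc e e0.
have tol : 0 < (1 - d) / 2 by lra.
have [s /andP[s0 sr] gapA] := classA_scale cA tol r0.
exists (s / 2); first by lra.
apply: (@le_trans _ _ (d * (d * (s / 2)))%:E).
  by rewrite lee_fin mulrA ler_pM2r// divr_gt0.
apply: (@Wasserstein_split_ge A p (s / 2) d e) => //.
- by rewrite divr_gt0.
- by rewrite /e; lra.
- by case: cA.
- move=> x y Ax Ay; rewrite mulrCA divff// mulr1 => /(gapA _ _ Ax Ay); lra.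
Qed.

End concentrated_to_sharp.

Section sharp_to_concentrated.
Context (R : realType) (mu : probability R R).

Lemma sharp_rate_clusters (p t b r : R) : 1 <= p -> sharp_rate mu p ->
  0 < t < 1 -> 0 < b -> t * b <= 1 -> 0 < r ->
  exists (h : R) (A : set R), [/\ 0 < h < r, measurable A,
    (mu (~` A) <= (8 * b)%:E)%E &
    forall x y, A x -> A y -> `|x - y| < h / 2 -> `|x - y| < 2 * t * h].
Proof.
move=> p1 sharp t01 b0 tb r0; have /andP[t0 t1] := t01.
have p0 : 0 < p by apply: lt_le_trans p1.
have q1 : (1 - t * b) `^ p^-1 < 1.
  have : (1 - t * b) `^ p^-1 < 1 `^ p^-1.
    rewrite gt0_ltr_powR ?invr_gt0// ?nnegrE ?subr_ge0//.
    by rewrite gtrBl mulr_gt0.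
  by rewrite powR1.
have : (((1 - t * b) `^ p^-1)%:E < limf_esup (fun h : R =>
    Wasserstein p mu (split_measure mu h) * (h^-1)%:E) (0 : R)^'+)%E.
  by rewrite sharp lte_fin.
move=> /limf_esup_right_gt/(_ r r0)[h hr W]; exists h.
have /andP[h0 _] := hr.
move: W; rewrite lte_pdivlMr// -EFinM => W.
have [A [mA muA gapA]] := cluster_decomposition p1 t01 h0 tb W.
by exists A.
Qed.

(** At stage [n] the clusters have relative size of order [1 / n] and the mass
    lost is [e / 2 ^ (n + 1)], so that the intersection of the stages loses at
    most [e]. *)
Lemma classA_of_sharp_rate (p eps : R) : 1 <= p -> sharp_rate mu p ->
  0 < eps -> exists2 A : set R, classA A & ((1 - eps)%:E <= mu A)%E.
Proof.
move=> p1 sharp eps0; pose e := Num.min eps 2^-1.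
have e0 : 0 < e by rewrite lt_min eps0; lra.
have e2 : e <= 2^-1 by rewrite ge_min lexx orbT.
(* With [s n] half of the scale [h] of stage [n], the bound [2 t h] is [4 t s],
   whence the factor [4]; the factor [8] is the loss of
   [cluster_decomposition]. *)
pose t (n : nat) : R := (n.+2%:R)^-1 / 4.
pose b (n : nat) : R := e / (2 ^ n.+1)%:R / 8.
have inv2 (n : nat) : 0 < (n.+2%:R : R)^-1 <= 2^-1.
  by rewrite invr_gt0 ltr0n lef_pV2 ?posrE ?ltr0n// ler_nat.
have t01 n : 0 < t n < 1 by rewrite /t; move: (_^-1) (inv2 n) => c; lra.
have b0 n : 0 < b n by rewrite /b !divr_gt0// ltr0n expn_gt0.
have b1 n : b n <= 1.
  rewrite /b ler_pdivrMr// ler_pdivrMr ?ltr0n ?expn_gt0//.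
  have : (1 : R) <= (2 ^ n.+1)%:R by rewrite ler1n expn_gt0.
  lra.
have tb n : t n * b n <= 1.
  have /andP[tn0 tn1] := t01 n.
  by rewrite mulr_ile1 ?(ltW (b0 n)) ?b1// ltW.
have r0 (n : nat) : 0 < (n.+1%:R : R)^-1 by rewrite invr_gt0 ltr0n.
have /choice[u hu] n : exists hA : R * set R,
    [/\ 0 < hA.1 < (n.+1%:R : R)^-1, measurable hA.2,
      (mu (~` hA.2) <= (8 * b n)%:E)%E &
      forall x y, hA.2 x -> hA.2 y -> `|x - y| < hA.1 / 2 ->
        `|x - y| < 2 * t n * hA.1].
  have [h [A hA]] := sharp_rate_clusters p1 sharp (t01 n) (b0 n) (tb n) (r0 n).
  by exists (h, A).
pose s n := (u n).1 / 2; pose A := \bigcap_n (u n).2.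
have mu_ n : measurable (u n).2 by have [] := hu n.
have mA : measurable A by exact: bigcapT_measurable.
have s0 n : 0 < s n by have [/andP[h0 _] _ _ _] := hu n; rewrite /s; lra.
have sn n : s n < n.+1%:R^-1.
  have [/andP[h0 h1] _ _ _] := hu n.
  by apply: le_lt_trans h1; rewrite /s; lra.
have nA : (mu (~` A) <= e%:E)%E.
  rewrite setC_bigcap.
  apply: (@le_trans _ _ (\sum_(n <oo) mu (~` (u n).2))%E).
    apply: measure_sigma_subadditive => // [n|]; first exact: measurableC.
    by apply: bigcupT_measurable => n; exact: measurableC.
  apply: le_trans (epsilon_trick0 xpredT (ltW e0)).
  apply: lee_nneseries => // n _; have [_ _ + _] := hu n.
  by rewrite /b mulrC divfK// pnatr_eq0.
have muA : ((1 - e)%:E <= mu A)%E.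
  move: nA; rewrite probability_setC//.
  rewrite -(fineK (fin_num_measure mu _ mA)) -EFinB !lee_fin; lra.
(* The supremum over the empty set is [-oo], so the set must be nonempty; this
   is why [e <= 1/2]. *)
have [x0 Ax0] : A !=set0.
  apply/set0P/eqP => A0; move: muA; rewrite A0 measure0 lee_fin; lra.
exists A; last by apply: le_trans muA; rewrite lee_fin lerD2l lerN2 ge_min lexx.
have radius_le n x : A x -> (local_radius A (s n) x <= (n.+2%:R^-1)%:E)%E.
  move=> Ax; apply: ereal_inf_lbound; exists (n.+2%:R^-1) => //.
  have /andP[n0 n1] := inv2 n; split; first by rewrite n0 (le_lt_trans n1)//; lra.
  move=> y [xy Ay]; rewrite closed_ballE; last exact: mulr_gt0.
  rewrite /closed_ball_ /=.
  move: xy; rewrite -ball_normE /= => xy; apply: ltW.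
  have [_ _ _ /(_ x y (Ax n I) (Ay n I) xy)] := hu n.
  by rewrite /t /s; set c := n.+2%:R^-1; congr (is_true (_ < _)); field.
have radius_ge0 n x : (0 <= local_radius A (s n) x)%E.
  by apply: le_ereal_inf_tmp => _ [r [/andP[/ltW r_ge0 _] _] <-]; rewrite lee_fin.
split=> //; exists s; split.
- move=> n; rewrite s0 (lt_le_trans (sn n))// invf_le1 ?ltr0n// ler1n//.
- apply: (@squeeze_cvgr _ _ _ _ (cst 0) (@harmonic R)).
  + by apply: nearW => n; rewrite !ltW// sn.
  + exact: cvg_cst.
  + exact: cvg_harmonic.
- apply: (@squeeze_cvge _ _ _ _ (cst 0%E) _ (fun n => (n.+2%:R^-1)%:E)).
  + apply: nearW => n; apply/andP; split.
      apply: (le_trans (radius_ge0 n x0)).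
      by apply: ereal_sup_ubound; exists x0.
    by apply: ge_ereal_sup => _ [x Ax <-]; exact: radius_le.
  + exact: cvg_cst.
  + apply: cvg_EFin; first exact: nearW.
    by have := @cvg_harmonic R; rewrite -cvg_shiftS.
Qed.

End sharp_to_concentrated.

Theorem theorem1 (R : realType) (mu : probability R R) :
  [<-> exists2 p : R, 1 <= p & sharp_rate mu p;
       forall p : R, 1 <= p -> sharp_rate mu p;
       forall eps : R, 0 < eps ->
         exists2 A : set R, classA A & ((1 - eps)%:E <= mu A)%E].
Proof.
have concentration p : 1 <= p -> sharp_rate mu p -> forall eps : R, 0 < eps ->
    exists2 A : set R, classA A & ((1 - eps)%:E <= mu A)%E.
  by move=> p1 sharp eps eps0; exact: classA_of_sharp_rate p1 sharp eps0.
tfae=> [[p p1 sharp] q q1|sharp|conc].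
- by apply: sharp_rate_of_classA => //; exact: concentration p1 sharp.
- exact: concentration (lexx 1) (sharp 1 (lexx 1)).
- by exists 1 => //; exact: sharp_rate_of_classA.
Qed.
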